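(* Let $\mathbb K$ be a field, $G=([n],E(G))$ a simple graph, $\mathcal S=(S_{ij})$ a family of gain sets on $G$ with values in $\mathbb K$, let $\pi$ be a nice partition of $\mathcal A(G_{\mathcal S})$, and let $\Pi:E(G)\to\pi$ be the induced map on edges. Assume that $G$ is a block. For every part $\pi_r$ of $\pi$, if $\Pi^{-1}(\pi_r)$ is nonempty, then it is a star. Moreover, the nonempty preimages have distinct centers: no vertex is a center of both $\Pi^{-1}(\pi_r)$ and $\Pi^{-1}(\pi_s)$ for two different parts $\pi_r\neq\pi_s$ with nonempty preimages.
   Context: Gain sets: $\mathcal S=(S_{ij})$ is a family of finite subsets of $\mathbb K$ indexed by ordered pairs of distinct vertices of $G$, with $S_{ji}=-S_{ij}=\{-a\mid a\in S_{ij}\}$ and $S_{ij}\neq\emptyset$ if and only if $ij\in E(G)$. Put $H_{ij}^a=\{x\in\mathbb K^n\mid x_i-x_j=a\}$ and $\mathcal A(G_{\mathcal S})=\{H_{ij}^a\mid a\in S_{ij},\ i<j\}$. For an edge $ij$, $\mathcal A_{ij}=\{H_{ij}^a\mid a\in S_{ij}\}=\mathcal A_{ji}$ is its parallel class. Block: ''$G$ is a block'' means that $G$ is connected and has no cut vertex; the one-vertex graph and the graph consisting of a single edge are included. Intersection poset: for a finite affine arrangement $\mathcal A$ in $V$, $L(\mathcal A)$ consists of $V$ and all nonempty intersections of hyperplanes of $\mathcal A$, ordered by reverse inclusion; the localization at $X\in L(\mathcal A)$ is $\mathcal A_X=\{H\in\mathcal A\mid X\subseteq H\}$. Nice partition: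 let $\pi=(\pi_1,\dots,\pi_s)$ be a partition of an affine arrangement $\mathcal A$ in $V$. A $p$-section of $\pi$ is a set $\{H_1,\dots,H_p\}\subseteq\mathcal A$ no two of whose members lie in the same part; it is independent if $H_1\cap\cdots\cap H_p$ is nonempty of codimension $p$. $\pi$ is independent if every section is independent. $\pi$ is nice if it is independent and, for every $X\in L(\mathcal A)\setminus\{V\}$, there is $i$ with $|\pi_i\cap\mathcal A_X|=1$. The empty partition of the empty arrangement is nice. Induced map: for a nice partition $\pi$ of $\mathcal A(G_{\mathcal S})$ and an edge $ij$, all hyperplanes of $\mathcal A_{ij}$ lie in one part of $\pi$; $\Pi(ij)$ denotes this part. Star: a star is a nonempty set of edges all incident with one common vertex; such a vertex is called a center of the star. *)

(* Defs.v *)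
From HB Require Import structures.
From mathcomp Require Import all_boot all_order all_algebra finmap.
From mathcomp Require Import boolp classical_sets.

Set Implicit Arguments.
Unset Strict Implicit.
Unset Printing Implicit Defensive.

Import GRing.Theory.
Local Open Scope classical_set_scope.
Local Open Scope ring_scope.

(** ** Graphs on [n] *)

Record simple_graph (n : nat) := SimpleGraph {
  adj :> rel 'I_n;
  adj_sym : symmetric adj;
  adj_irr : irreflexive adj }.

Section Graphs.
Variables (n : nat) (G : simple_graph n).

Definition is_edge : pred {set 'I_n} :=
  fun E => [exists i, [exists j, adj G i j && (E == [set i; j]%SET)]].

Definition edge := {E : {set 'I_n} | is_edge E}.

Lemma is_edge_pair i j : adj G i j -> is_edge [set i; j]%SET.
Proof. by move=> ij; apply/existsP; exists i; apply/existsP; exists j; rewrite ij eqxx. Qed.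

Definition mk_edge i j (ij : adj G i j) : edge := exist (fun E => is_edge E) _ (is_edge_pair ij).

Definition connected_graph := forall x y, connect (adj G) x y.

Definition adj_del (v : 'I_n) : rel 'I_n :=
  fun x y => [&& adj G x y, x != v & y != v].

Definition cut_vertex (v : 'I_n) :=
  exists x y, [/\ x != v, y != v, connect (adj G) x y
                & ~~ connect (adj_del v) x y].

Definition block := connected_graph /\ ~ exists v, cut_vertex v.

Definition center (v : 'I_n) (F : set edge) := forall E, F E -> v \in val E.

Definition star (F : set edge) := F !=set0 /\ exists v, center v F.

End Graphs.

(** ** Nice partitions of affine arrangements in K^n *)

Section Arrangements.
Variables (K : fieldType) (n : nat).
Local Notation V := 'rV[K]_n.

Definition affine_codim (X : set V) (p : nat) :=
  exists (x0 : V) (W : {vspace V}),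
    X = [set x | x - x0 \in W] /\ (\dim W + p = n)%N.

Variable A : set (set V).

(* The empty intersection is the whole space V. *)
Definition intersection_poset : set (set V) :=
  [set X | X !=set0 /\ exists2 B, B `<=` A & X = \bigcap_(H in B) H].

Definition localization (X : set V) : set (set V) := [set H | A H /\ X `<=` H].

Variables (s : nat) (pi : 'I_s -> set (set V)).

(* When [pi] is a partition of A, such an [H] is automatically injective. *)
Definition is_section (p : nat) (H : 'I_p -> set V) :=
  (forall k, A (H k)) /\
  (forall k l r, pi r (H k) -> pi r (H l) -> k = l).

Definition independent_section (p : nat) (H : 'I_p -> set V) :=
  \bigcap_k H k !=set0 /\ affine_codim (\bigcap_k H k) p.

Definition independent_partition :=
  forall (p : nat) (H : 'I_p -> set V), is_section H -> independent_section H.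

Definition nice_partition :=
  [/\ partition [set: 'I_s] pi A,
      independent_partition
    & forall X, intersection_poset X -> X <> [set: V] ->
        exists i H, pi i `&` localization X = [set H] ].

End Arrangements.

(** ** Gain sets and their arrangements *)

Record gain_sets (K : fieldType) (n : nat) (G : simple_graph n) := GainSets {
  gains :> 'I_n -> 'I_n -> {fset K};
  gainsN : forall i j, i != j -> gains j i = [fset - a | a in gains i j]%fset;
  gains_adj : forall i j, i != j -> (gains i j != fset0) = adj G i j }.

Definition hyperplane (K : fieldType) (n : nat) (i j : 'I_n) (a : K)
  : set 'rV[K]_n := [set x | x 0 i - x 0 j = a].

Section GainArrangement.
Variables (K : fieldType) (n : nat) (G : simple_graph n) (S : gain_sets K G).

Definition gain_arrangement : set (set 'rV[K]_n) :=
  [set H | exists (i j : 'I_n) a, [/\ (i < j)%N, a \in S i j & H = hyperplane i j a]].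

Definition parallel_class (i j : 'I_n) : set (set 'rV[K]_n) :=
  [set H | exists2 a, a \in S i j & H = hyperplane i j a].

Lemma parallel_classC i j : i != j -> parallel_class i j = parallel_class j i.
Proof.
have sub k l : k != l -> parallel_class k l `<=` parallel_class l k.
  move=> kl _ [a Sa ->]; exists (- a).
    by rewrite (gainsN S kl); apply/imfsetP; exists a.
  apply/seteqP; split=> x; rewrite /hyperplane /= -(opprB (x 0 k)).
    by move=> ->.
  by move/oppr_inj.
by move=> ij; apply/seteqP; split; apply: sub; rewrite // eq_sym.
Qed.

Lemma parallel_class_sub i j : i != j -> parallel_class i j `<=` gain_arrangement.
Proof.
have sub (k l : 'I_n) : (k < l)%N -> parallel_class k l `<=` gain_arrangement.
  by move=> kl _ [a Sa ->]; exists k, l, a.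
move=> ij; case: (ltngtP i j) => [||/val_inj eij]; first exact: sub.
  by rewrite parallel_classC //; apply: sub.
by rewrite eij eqxx in ij.
Qed.

Variables (s : nat) (pi : 'I_s -> set (set 'rV[K]_n)).
Hypothesis pi_nice : nice_partition gain_arrangement pi.

Lemma parallel_class_part i j :
  adj G i j -> exists r, parallel_class i j `<=` pi r.
Proof.
move=> ij; case: pi_nice => -[cov triv _] indep _.
have nij : i != j by apply: contraTneq ij => ->; rewrite adj_irr.
have part H : parallel_class i j H -> exists r, pi r H.
  move=> /(parallel_class_sub nij); rewrite -cov.
  by case=> r _ piH; exists r.
have /fset0Pn[a Sa] : S i j != fset0 by rewrite gains_adj.
have [|r piHa] := part (hyperplane i j a); first by exists a.
exists r => H [b Sb eH].
have [|t piH] := part H; first by exists b.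
have [<- //|ntr] := eqVneq t r.
pose F (k : 'I_2) := if k == 0 then hyperplane i j a else H.
have F0 k : k = 0 -> F k = hyperplane i j a by move=> ->.
have F1 k : k != 0 -> F k = H by rewrite /F => /negPf->.
have disj u : pi u (hyperplane i j a) -> pi u H -> False.
  move=> ua uH; move/eqP: ntr; apply.
  have -> : t = u by apply: triv => //; exists H.
  by apply: triv => //; exists (hyperplane i j a).
have [|[x Fx] _] := indep 2%N F.
  split=> [k|k l u].
    apply: (parallel_class_sub nij); rewrite /F.
    by case: ifP => _; [exists a | exists b].
  have [k0|k0] := eqVneq k 0; have [l0|l0] := eqVneq l 0.
  - by rewrite k0 l0.
  - by rewrite F0 // F1 // => /disj h /h.
  - by rewrite F1 // F0 // => h /disj /(_ h).
  - by move=> _ _; apply: val_inj; case: k l k0 l0 => [[|[]]] // ? [[|[]]].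
have /= := Fx 0 I; rewrite F0 // => xa.
have /= := Fx 1 I; rewrite F1 // eH /hyperplane /= => xb.
by rewrite -xb xa.
Qed.

Definition edge_class (E : edge G) : set (set 'rV[K]_n) :=
  [set H | exists i j, val E = [set i; j]%SET /\ parallel_class i j H].

Lemma edge_class_mk i j (ij : adj G i j) :
  edge_class (mk_edge ij) = parallel_class i j.
Proof.
have nij : i != j by apply: contraTneq ij => ->; rewrite adj_irr.
apply/seteqP; split=> H; last by exists i, j.
case=> k [l] [/= /setP eE kl].
have := eE i; have := eE j; have := eE k; have := eE l.
rewrite !inE !eqxx ?orbT => /orP lij /orP kij /esym/orP jkl /esym/orP ikl.
case: ikl jkl kl nij => /eqP -> [] /eqP ->; rewrite ?eqxx //.
by move=> kl nlk; rewrite parallel_classC.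
Qed.

Lemma edge_class_part (E : edge G) : exists r, edge_class E `<=` pi r.
Proof.
case: E => E hE; have [i /existsP[j /andP[ij /eqP eE]]] := existsP hE.
have -> : exist (fun E => is_edge G E) E hE = mk_edge ij by apply: val_inj.
by rewrite edge_class_mk; apply: parallel_class_part.
Qed.

(* Parts are designated by their index; they are nonempty and disjoint, so
   distinct indices are the same as distinct parts. *)
Definition induced_map (E : edge G) : 'I_s := projT1 (cid (edge_class_part E)).

Lemma induced_mapP i j (ij : adj G i j) :
  parallel_class i j `<=` pi (induced_map (mk_edge ij)).
Proof. by rewrite -edge_class_mk; apply: (projT2 (cid (edge_class_part _))). Qed.

End GainArrangement.

(* Main.v *)
Require Import Defs.
From mathcomp Require Import all_boot all_order all_algebra finmap.
From mathcomp Require Import boolp classical_sets.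
From mathcomp Require Import zify ring.

(** Call two edges equally coloured when [induced_map] sends them to the same
    part. Two local facts about this colouring carry the proof.

    Niceness at the rank-two flat [X = H1 `&` H2], for two hyperplanes [H1],
    [H2] of one part [r], provides a hyperplane through [X] lying in another
    part ([nice_third_hyperplane]). If [H1] and [H2] come from vertex-disjoint
    edges, every hyperplane of the arrangement through [X] belongs to one of
    these two edges, hence to [r]; so equally coloured edges meet
    ([coloured_meet]). If they come from edges [v i] and [v j], the only
    remaining edge is [i j], so [i j] is an edge of another colour
    ([coloured_chord]). A family of pairwise meeting edges is a star or a
    triangle, and [coloured_chord] excludes the triangle.

    Independence forbids rainbow cycles: a closed walk whose edges have
    distinct colours would give a section in which one hyperplane contains the
    intersection of the others ([closed_walk_not_section]).

    Suppose now that [v] is a center for two colours, with edges [v x] and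
    [v y]. As [v] is not a cut vertex, there is a shortest path from [x] to [y]
    avoiding [v]. Two equally coloured edges of that path would meet, hence be
    consecutive, and [coloured_chord] would give a shortcut; so the path is
    rainbow. Its colours differ from those of [v x] and [v y], which occur only
    at [v], and so closing the path through [v] gives a rainbow cycle. *)

Set Implicit Arguments.
Unset Strict Implicit.
Unset Printing Implicit Defensive.

Import GRing.Theory.
Local Open Scope classical_set_scope.
Local Open Scope ring_scope.

(** * Shortest paths *)

Lemma connect_shortest_path (T : finType) (e : rel T) (x y : T) :
  connect e x y ->
  exists p : seq T, [/\ path e x p, last x p = y, uniq (x :: p) &
    forall (i : nat) (z : T), (i.+1 < size p)%N ->
      ~~ e (nth z (x :: p) i) (nth z p i.+1)].
Proof.
move=> /connectP[p0 p0P p0y].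
pose P m := `[< exists p, [/\ path e x p, last x p = y & size p = m] >].
have exP : exists m, P m by exists (size p0); apply/asboolP; exists p0.
case: (ex_minnP exP) => m /asboolP[p [pP py pm]] minm.
have min_p q : path e x q -> last x q = y -> (size p <= size q)%N.
  by move=> qP qy; rewrite pm; apply: minm; apply/asboolP; exists q.
case/shortenP: pP py min_p => q qP uq sub qy min_p.
exists q; split=> // i z ilt; apply/negP => short.
have {}min_q w : path e x w -> last x w = y -> (size q <= size w)%N.
  move=> wP wy; apply: leq_trans (min_p w wP wy).
  by apply: uniq_leq_size sub; case/andP: uq.
have ile : (i <= size q)%N by do 2 apply: ltnW.
(* An edge from the vertex before [nth z q i] to the vertex after it would allow
   deleting [nth z q i] from [q]. *)
have lastE : last x (take i q) = nth z (x :: q) i.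
  by rewrite (last_nth z) size_takel //; case: (i) => //= k; rewrite nth_take.
have dropE : drop i.+1 q = nth z q i.+1 :: drop i.+2 q by rewrite -drop_nth.
have takeP : path e x (take i q).
  by move: qP; rewrite -{1}(cat_take_drop i q) cat_path => /andP[].
have dropP : path e (nth z q i.+1) (drop i.+2 q).
  move: qP; rewrite -{1}(cat_take_drop i.+1 q) cat_path dropE /=.
  by case/and3P.
have := min_q (take i q ++ drop i.+1 q).
rewrite cat_path takeP lastE dropE /= short dropP -dropE.
rewrite [last x (_ ++ _)]last_cat dropE /=.
rewrite -[in last _ _ = y]qy -[in X in _ = X](cat_take_drop i.+1 q) last_cat dropE /=.
move=> /(_ isT erefl); rewrite -dropE size_cat size_takel // size_drop.
by rewrite subnS addnC; move: (ltnW ilt); lia.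
Qed.

(** * Codimension of affine subspaces *)

Lemma affine_codim_unique (K : fieldType) (n : nat) (X : set 'rV[K]_n) p q :
  affine_codim X p -> affine_codim X q -> p = q.
Proof.
move=> [x [W [XW dW]]] [y [U [XU dU]]].
have XyW : X y by rewrite XU /= subrr mem0v.
have yxW : y - x \in W by move: XyW; rewrite XW.
suff WU : W = U by apply/eqP; rewrite -(eqn_add2l (\dim W)) dW WU dU.
apply/vspaceP => w.
have XWU : X (y + w) = (w \in U) :> Prop.
  by rewrite XU /= addrAC subrr add0r.
have XWW : X (y + w) = (w \in W) :> Prop.
  rewrite XW /= addrAC; congr is_true; apply/idP/idP => [h|]; last exact: memvD.
  by rewrite -(addKr (y - x) w) addrC memvB.
by apply/idP/idP => h; [rewrite -XWU XWW | rewrite -XWW XWU].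
Qed.

(** * The colouring of edges by a nice partition *)

Section Colouring.
Variables (K : fieldType) (n : nat) (G : simple_graph n) (S : gain_sets K G).
Variables (s : nat) (pi : 'I_s -> set (set 'rV[K]_n)).
Hypothesis pi_nice : nice_partition (gain_arrangement S) pi.

Implicit Types (i j k l : 'I_n) (r t : 'I_s).

(** Stated on ordered pairs of vertices, where hyperplanes live, rather than on
    edges as two-element sets; [coloured_preimage] and [edge_coloured] translate
    between this relation and [induced_map]. *)
Definition coloured r i j := adj G i j /\ parallel_class S i j `<=` pi r.

Lemma adj_neq i j : adj G i j -> i != j.
Proof. by move=> ij; apply: contraTneq ij => ->; rewrite adj_irr. Qed.

Lemma coloured_neq r i j : coloured r i j -> i != j.
Proof. by case=> /adj_neq. Qed.

Lemma colouredC r i j : coloured r i j -> coloured r j i.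
Proof.
case=> ij sub; split; first by rewrite adj_sym.
by rewrite -parallel_classC // adj_neq.
Qed.

Lemma adj_gain i j : adj G i j -> exists a, a \in S i j.
Proof. by move=> ij; apply/fset0Pn; rewrite gains_adj // adj_neq. Qed.

Lemma part_unique r t H : pi r H -> pi t H -> r = t.
Proof.
by have [[_ triv _] _ _] := pi_nice => rH tH; apply: triv => //; exists H.
Qed.

Lemma coloured_hyperplane r i j a :
  adj G i j -> a \in S i j -> pi r (hyperplane i j a) -> coloured r i j.
Proof.
move=> ij Sa rH; split=> //.
have [t sub] := parallel_class_part pi_nice ij.
by have -> // : r = t; apply: (part_unique rH); apply: sub; exists a.
Qed.

Lemma coloured_unique r t i j : coloured r i j -> coloured t i j -> r = t.
Proof.
case=> ij subr [_ subt]; have [a Sa] := adj_gain ij.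
by apply: (@part_unique _ _ (hyperplane i j a)); [apply: subr|apply: subt]; exists a.
Qed.

Lemma coloured_induced_map i j (ij : adj G i j) :
  coloured (induced_map pi_nice (mk_edge ij)) i j.
Proof. by split=> //; apply: induced_mapP. Qed.

Lemma coloured_preimage r i j : coloured r i j ->
  exists2 E : edge G, induced_map pi_nice E = r & val E = [set i; j]%SET.
Proof.
move=> rij; have [ij _] := rij; exists (mk_edge ij) => //.
exact: coloured_unique (coloured_induced_map ij) rij.
Qed.

Lemma edge_coloured (E : edge G) :
  exists i j, val E = [set i; j]%SET /\ coloured (induced_map pi_nice E) i j.
Proof.
case: E => E hE; have [i /existsP[j /andP[ij /eqP eE]]] := existsP hE.
exists i, j; split=> //.
have -> : exist (fun E => is_edge G E) E hE = mk_edge ij by apply: val_inj.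
exact: coloured_induced_map.
Qed.

Lemma arrangement_sub_part r H : pi r H -> gain_arrangement S H.
Proof. by have [[<- _ _] _ _] := pi_nice => rH; exists r. Qed.

(** * Consequences of niceness in rank two *)

(** The part singled out by niceness at the intersection cannot be [r], which
    already has two hyperplanes there. *)
Lemma nice_third_hyperplane r H1 H2 :
  pi r H1 -> pi r H2 -> H1 <> H2 -> H1 `&` H2 !=set0 ->
  exists t H, [/\ t <> r, pi t H & H1 `&` H2 `<=` H].
Proof.
move=> r1 r2 ne12 X0; have [_ _ nice] := pi_nice.
have A1 := arrangement_sub_part r1; have A2 := arrangement_sub_part r2.
have [||t [H eqH]] := nice (H1 `&` H2).
- split=> //; exists [set H1; H2] => [H [] ->|] //.
  apply/seteqP; split=> [x [x1 x2] H [] ->|x Hx] //.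
  by split; apply: Hx; [left|right].
- move=> XT; apply: ne12.
  have all H : H1 `&` H2 `<=` H -> H = setT.
    by rewrite XT => sub; apply/seteqP; split.
  have -> : H1 = setT by apply: all => x [].
  by apply/esym/all => x [].
have [tH [AH sub]] : (pi t `&` localization (gain_arrangement S) (H1 `&` H2)) H.
  by rewrite eqH.
exists t, H; split=> // tr; apply: ne12; rewrite tr in eqH.
have in1 : [set H] H1 by rewrite -eqH; split=> //; split=> // x [].
have in2 : [set H] H2 by rewrite -eqH; split=> //; split=> // x [].
by rewrite in1 in2.
Qed.

(** The condition on [D] says that translation by the indicator vector of [D]
    preserves both hyperplanes, hence also the one containing their
    intersection. *)
Lemma coloured_third_edge r i j k l :
  coloured r i j -> coloured r k l -> l != i -> l != j ->
  exists t p q, [/\ t <> r, coloured t p q &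
    forall D : pred 'I_n, D i = D j -> D k = D l -> D p = D q].
Proof.
move=> rij rkl li lj; have [[ij subij] [kl subkl]] := (rij, rkl).
have [nij nkl] := (adj_neq ij, adj_neq kl).
have [[a Sa] [b Sb]] := (adj_gain ij, adj_gain kl).
(* [x b] is a common point of the two hyperplanes; [x c] with [c <> b] shows
   that they differ. *)
pose y m := if m == i then a else 0.
pose x c : 'rV[K]_n := \row_m (if m == l then y k - c else y m).
have x1 c : hyperplane i j a (x c).
  rewrite /hyperplane /= !mxE /y eqxx ![_ == l]eq_sym (negPf li) (negPf lj).
  by rewrite eq_sym (negPf nij) subr0.
have x2 c : hyperplane k l b (x c) <-> c = b.
  rewrite /hyperplane /= !mxE eqxx (negPf nkl) opprB addrCA subrr addr0.
  by [].
have [||||t [H [tr tH sub]]] :=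
    @nice_third_hyperplane r (hyperplane i j a) (hyperplane k l b).
- by apply: subij; exists a.
- by apply: subkl; exists b.
- move=> e; have := x1 (b + 1); rewrite e => /x2 /eqP.
  by rewrite -subr_eq0 addrAC subrr add0r oner_eq0.
- by exists (x b); split=> //; apply/x2.
have [p [q [c [pq Sc eH]]]] := arrangement_sub_part tH.
have npq : p != q by apply: contraTneq pq => ->; rewrite ltnn.
exists t, p, q; split=> // [|D Dij Dkl].
  apply: (@coloured_hyperplane _ _ _ c); rewrite -?eH //.
  by rewrite -(gains_adj S) //; apply/fset0Pn; exists c.
pose d : 'rV[K]_n := \row_m (D m)%:R.
have shift i' j' a' z : D i' = D j' ->
    hyperplane i' j' a' z -> hyperplane i' j' a' (z + d).
  by rewrite /hyperplane /= !mxE => ->; rewrite opprD addrACA subrr addr0.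
have z0 : H (x b) by apply: sub; split=> //; apply/x2.
have z1 : H (x b + d).
  by apply: sub; split; apply: shift => //; apply/x2.
move: z0 z1; rewrite eH /hyperplane /= !mxE opprD addrACA => ->.
move=> /eqP; rewrite -[in X in _ == X](addr0 c) (inj_eq (addrI c)) subr_eq0.
by case: (D p) (D q) => [] [] //; rewrite ?oner_eq0 // eq_sym oner_eq0.
Qed.

Lemma coloured_pred2 r i j k l :
  coloured r k l -> pred2 i j k -> pred2 i j l -> coloured r i j.
Proof.
move=> rkl; have := coloured_neq rkl.
move=> nkl /orP[]/eqP ek /orP[]/eqP el; move: rkl nkl; rewrite ek el ?eqxx //.
by move=> /colouredC.
Qed.

(** The indicators of [{i, j}], of [{k, l}] and of single vertices, fed to
    [coloured_third_edge], leave only the two given edges as candidates for the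
    third one when these are disjoint. *)
Lemma coloured_meet r i j k l :
  coloured r i j -> coloured r k l -> l != i -> l != j -> k = i \/ k = j.
Proof.
move=> rij rkl li lj.
have [|ki] := eqVneq k i; first by left.
have [|kj] := eqVneq k j; first by right.
have [t [p [q [tr tpq Dpq]]]] := coloured_third_edge rij rkl li lj.
have [Dij Dkl] := (Dpq (pred2 i j), Dpq (pred2 k l)).
exfalso; apply: tr; have [pij|pij] := boolP (pred2 i j p).
  apply: coloured_unique rij; apply: (coloured_pred2 tpq pij).
  rewrite -Dij //= ?eqxx ?orbT //.
  by rewrite (negPf ki) (negPf kj) (negPf li) (negPf lj).
have [pkl|pkl] := boolP (pred2 k l p).
  apply: coloured_unique rkl; apply: (coloured_pred2 tpq pkl).
  rewrite -Dkl //= ?eqxx ?orbT // ![i == _]eq_sym ![j == _]eq_sym.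
  by rewrite (negPf ki) (negPf kj) (negPf li) (negPf lj).
have := coloured_neq tpq; move: pij pkl; rewrite /= !negb_or.
move=> /andP[pi_ pj] /andP[pk pl].
have := Dpq (pred1 p); rewrite /= eqxx ![_ == p]eq_sym.
rewrite (negPf pi_) (negPf pj) (negPf pk) (negPf pl).
by move=> /(_ erefl erefl) <-.
Qed.

(** Here single vertices suffice as test sets: the third edge has both ends in
    [{v, i, j}], and it differs from [v i] and [v j] by its colour. *)
Lemma coloured_chord r v i j :
  coloured r v i -> coloured r v j -> i != j ->
  exists2 t, t <> r & coloured t i j.
Proof.
move=> rvi rvj nij; have [nvi nvj] := (coloured_neq rvi, coloured_neq rvj).
have [||t [p [q [tr tpq Dpq]]]] := coloured_third_edge rvi rvj.
- by rewrite eq_sym.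
- by rewrite eq_sym.
have tNv k : pred2 i j k -> ~ coloured t v k.
  move=> /orP[]/eqP-> tv; apply: tr; last exact: coloured_unique rvj.
  exact: coloured_unique rvi.
have vertex k : p == k \/ q == k -> v == k \/ pred2 i j k.
  move=> pqk; have [vk|vk] := eqVneq v k; [by left|right].
  apply: contraT => ijk; have := Dpq (pred1 k); move: ijk => /=.
  rewrite negb_or ![k == _]eq_sym => /andP[/negPf-> /negPf->].
  move=> /(_ (negPf vk) (negPf vk)) e.
  have := coloured_neq tpq; case: pqk e => /eqP ->; rewrite eqxx.
    by move=> /esym/eqP ->; rewrite eqxx.
  by move=> /eqP ->; rewrite eqxx.
have [vp|pij] := vertex p (or_introl (eqxx p)).
  have [vq|/tNv[]] := vertex q (or_intror (eqxx q)); last by rewrite (eqP vp).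
  by have := coloured_neq tpq; rewrite -(eqP vp) -(eqP vq) eqxx.
have [vq|qij] := vertex q (or_intror (eqxx q)).
  by have /tNv[] := pij; rewrite (eqP vq); apply: colouredC.
by exists t => //; apply: coloured_pred2 tpq pij qij.
Qed.

(** If no vertex is a center, a given edge [i j] is met by an edge [j k] that
    avoids [i] and by an edge [i l] that avoids [j]; these two meet only if
    [k = l], which makes a triangle of a single colour. *)
Lemma coloured_preimage_star r :
  (induced_map pi_nice) @^-1` [set r] !=set0 ->
  star ((induced_map pi_nice) @^-1` [set r]).
Proof.
move=> [E /= Er]; split; first by exists E.
have [i [j [_ rij]]] := edge_coloured E; rewrite Er in rij.
have off v : ~ center v (induced_map pi_nice @^-1` [set r]) ->
    exists k l, [/\ coloured r k l, k != v & l != v].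
  move=> /existsNP[F /not_implyP[/= Fr vF]].
  have [k [l [eF rkl]]] := edge_coloured F; exists k, l; rewrite -Fr.
  by move/negP: vF; rewrite eF !inE negb_or ![v == _]eq_sym => /andP[].
have end_at u v : coloured r u v -> ~ center u (induced_map pi_nice @^-1` [set r]) ->
    exists2 k, coloured r v k & k != u.
  move=> ruv /off[k [l [rkl ku lu]]].
  have [e|lv] := eqVneq l v; first by exists k => //; rewrite -e; apply: colouredC.
  have [/eqP|e] := coloured_meet ruv rkl lu lv; first by rewrite (negPf ku).
  by exists l => //; rewrite -e.
apply: contrapT => /forallNP nocenter.
have [k rjk ki] := end_at _ _ rij (nocenter i).
have [l ril lj] := end_at _ _ (colouredC rij) (nocenter j).
have [e|lk] := eqVneq l k.
  have [|t tr tik] := coloured_chord (colouredC rij) rjk.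
    by rewrite eq_sym.
  by apply: tr; apply: coloured_unique tik _; rewrite -e.
have [/eqP|/eqP] := coloured_meet rjk ril lj lk.
  by rewrite (negPf (coloured_neq rij)).
by rewrite eq_sym (negPf ki).
Qed.

(** * Rainbow cycles and distinct centers *)

(** All coordinates along the walk are determined, up to a common translation,
    by its steps other than the closing one. So, if the section is to have a
    nonempty intersection, the closing hyperplane contains the intersection of
    the others, and this set would have two different codimensions. *)
Lemma closed_walk_not_section m (c : nat -> 'I_n) (a : nat -> K) :
  c m.+1 = c 0 ->
  ~ is_section (gain_arrangement S) pi
      (fun k : 'I_m.+1 => hyperplane (c k) (c k.+1) (a k)).
Proof.
move=> closed; set H := (fun k : 'I_m.+1 => _) => Hsec.
have [_ indep _] := pi_nice.
have [[x Hx] codH] := indep _ _ Hsec.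
pose H' (k : 'I_m) := H (widen_ord (leqnSn m) k).
have H'sec : is_section (gain_arrangement S) pi H'.
  case: Hsec => HA Hinj; split=> [k|k l r rk rl]; first exact: HA.
  by apply: val_inj; have /(congr1 val) := Hinj _ _ _ rk rl.
have [_ codH'] := indep _ _ H'sec.
suff eqX : \bigcap_k H k = \bigcap_k H' k.
  rewrite eqX in codH; have /eqP := affine_codim_unique codH codH'.
  by rewrite eqn_leq ltnn.
apply/seteqP; split=> y Hy k _; first exact: Hy.
have step (q : nat) : (q < m)%N -> y 0 (c q.+1) - x 0 (c q.+1) = y 0 (c q) - x 0 (c q).
  move=> qm; have := Hx (widen_ord (leqnSn m) (Ordinal qm)) I.
  have := Hy (Ordinal qm) I; rewrite /H' /H /hyperplane /= => <- e.
  have -> : x 0 (c q.+1) = x 0 (c q) - (y 0 (c q) - y 0 (c q.+1)).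
    by rewrite -e; ring.
  by ring.
have const (q : nat) : (q <= m)%N -> y 0 (c q) - x 0 (c q) = y 0 (c 0) - x 0 (c 0).
  by elim: q => // q IH qm; rewrite step // IH // ltnW.
have := Hx k I; rewrite /H /hyperplane /= => <-.
have kS : y 0 (c k.+1) - x 0 (c k.+1) = y 0 (c 0) - x 0 (c 0).
  have := ltn_ord k; rewrite ltnS leq_eqVlt => /predU1P[->|/const//].
  by rewrite closed.
have yk1 : y 0 (c k.+1) = x 0 (c k.+1) + (y 0 (c k) - x 0 (c k)).
  by rewrite (const k) -1?ltnS // -kS; ring.
by rewrite yk1; ring.
Qed.

(** The path is closed up through [v]: the walk [v, x, ..., y, v] visits
    [nth v (v :: x :: p)], whose default value is the final [v]. *)
Lemma coloured_centers_distinct r t v : block G -> r <> t ->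
  (induced_map pi_nice) @^-1` [set r] !=set0 ->
  (induced_map pi_nice) @^-1` [set t] !=set0 ->
  center v ((induced_map pi_nice) @^-1` [set r]) ->
  center v ((induced_map pi_nice) @^-1` [set t]) -> False.
Proof.
move=> [conn nocut] rt r0 t0 cr ct.
have at_center q k l : center v (induced_map pi_nice @^-1` [set q]) ->
    coloured q k l -> v = k \/ v = l.
  move=> cq /coloured_preimage[E Eq eE]; have := cq _ Eq.
  by rewrite eE !inE => /orP[]/eqP; [left|right].
have edge_at q : induced_map pi_nice @^-1` [set q] !=set0 ->
    center v (induced_map pi_nice @^-1` [set q]) -> exists x, coloured q v x.
  move=> [E /= Eq] cq; have [k [l [_ ekl]]] := edge_coloured E.
  rewrite Eq in ekl; have [->|->] := at_center _ _ _ cq ekl; first by exists l.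
  by exists k; apply: colouredC.
have [[x rvx] [y tvy]] := (edge_at _ r0 cr, edge_at _ t0 ct).
have [nvx nvy] := (coloured_neq rvx, coloured_neq tvy).
have [p [pP py up short]] : exists p, [/\ path (adj_del G v) x p, last x p = y,
    uniq (x :: p) & forall (i : nat) z, (i.+1 < size p)%N ->
      ~~ adj_del G v (nth z (x :: p) i) (nth z p i.+1)].
  apply: connect_shortest_path; apply: contraT => ncon; case: nocut; exists v.
  by exists x, y; rewrite ![_ == v]eq_sym.
pose c := nth v (v :: x :: p); pose m := (size p).+1.
have c1y : c m = y by rewrite /c /m /= -py (last_nth v).
have cm : c m.+1 = v by rewrite /c /m /= nth_default.
have del (k : nat) : (0 < k < m)%N -> adj_del G v (c k) (c k.+1).
  by case: k => // k km; apply: (elimT (pathP v) pP k km).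
have walk (k : nat) : (k <= m)%N -> adj G (c k) (c k.+1).
  rewrite leq_eqVlt => /predU1P[->|km].
    by rewrite c1y cm; case: (colouredC tvy).
  by case: k km => [_|k km]; [case: rvx|case/and3P: (del k.+1 km)].
have cNv (k : nat) : (0 < k <= m)%N -> v != c k.
  case/andP=> k0; rewrite leq_eqVlt => /predU1P[->|km]; first by rewrite c1y.
  by have := del k; rewrite k0 km => /(_ isT)/and3P[_ + _]; rewrite eq_sym.
have inner (k : nat) q : (0 < k < m)%N -> coloured q (c k) (c k.+1) -> q <> r /\ q <> t.
  move=> /andP[k0 km] qk.
  have nv1 : v != c k by apply: cNv; rewrite k0 ltnW.
  have nv2 : v != c k.+1 by apply: cNv.
  split=> e; move: qk; rewrite e => /at_center; [move/(_ cr)|move/(_ ct)].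
    by case=> /eqP; rewrite ?(negPf nv1) ?(negPf nv2).
  by case=> /eqP; rewrite ?(negPf nv1) ?(negPf nv2).
have first_r q : coloured q (c 0) (c 1) -> q = r by move/coloured_unique; apply.
have last_t q : coloured q (c m) (c m.+1) -> q = t.
  by rewrite c1y cm => /coloured_unique; apply; apply: colouredC.
have lt_rainbow (k l : nat) q : (k < l <= m)%N ->
    coloured q (c k) (c k.+1) -> coloured q (c l) (c l.+1) -> False.
  case/andP=> kl lm qk ql; case: k kl qk => [|k] kl qk.
    move: lm; rewrite leq_eqVlt => /predU1P[lm|lm].
      by apply: rt; rewrite -(first_r _ qk) -(@last_t q) // -lm.
    by have [+ _] := inner l q (introT andP (conj kl lm)) ql; apply; apply: first_r.
  have km : (k.+1 < m)%N by apply: leq_trans kl lm.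
  have [_ qt] := inner k.+1 q km qk.
  move: lm; rewrite leq_eqVlt => /predU1P[lm|lm].
    by apply: qt; apply: last_t; rewrite -lm.
  have neq (a b : nat) : (a < b < m)%N -> c b.+1 != c a.+1.
    case/andP=> ab bm; have am := ltn_trans ab bm.
    by rewrite [c _ == _](@nth_uniq _ v (x :: p)) ?gtn_eqF.
  case: l kl lm ql => // l kl lm ql.
  (* Two equally coloured edges inside the path meet, so they are consecutive,
     and the chord of the other colour shortens the path. *)
  have l1 : c l.+2 != c k.+1 by apply: neq; rewrite lm ltnW.
  have l2 : c l.+2 != c k.+2 by apply: neq; rewrite lm andbT.
  have {}kl : (k < l)%N by [].
  have [/eqP|/eqP e] := coloured_meet qk ql l1 l2.
    by rewrite (negPf (neq _ _ _)) // kl ltnW.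
  have lk : l = k.+1.
    apply/eqP; apply: contraT => lk; move: e.
    by rewrite (negPf (neq _ _ _)) // ltn_neqAle eq_sym lk kl ltnW.
  rewrite lk in ql lm l1.
  have [|u _ [adju _]] := coloured_chord (colouredC qk) ql.
    by rewrite eq_sym.
  have /negP := short k v lm; apply; apply/and3P; split=> //.
    by rewrite eq_sym; apply: (cNv k.+1 (ltnW km)).
  by rewrite eq_sym; apply: (cNv k.+3 lm).
have gain (k : nat) : exists a, (k <= m)%N -> a \in S (c k) (c k.+1).
  have [/walk/adj_gain[a Sa]|] := leqP k m; first by exists a.
  by exists 0.
have {gain}[a Sa] := choice gain.
apply: (@closed_walk_not_section m c a); first by rewrite cm.
have Sk (k : 'I_m.+1) : a k \in S (c k) (c k.+1) by apply: Sa; rewrite -ltnS.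
have Ak (k : 'I_m.+1) : adj G (c k) (c k.+1) by apply: walk; rewrite -ltnS.
split=> [k|k l q qk ql].
  by apply: (parallel_class_sub (adj_neq (Ak k))); exists (a k).
have {}qk := coloured_hyperplane (Ak k) (Sk k) qk.
have {}ql := coloured_hyperplane (Ak l) (Sk l) ql.
case: (ltngtP k l) => [kl|lk|/val_inj//]; exfalso.
  by apply: (lt_rainbow k l q) => //; rewrite kl; exact: ltn_ord l.
by apply: (lt_rainbow l k q) => //; rewrite lk; exact: ltn_ord k.
Qed.

End Colouring.

Theorem proposition3p5 (K : fieldType) (n : nat) (G : simple_graph n)
    (S : gain_sets K G) (s : nat) (pi : 'I_s -> set (set 'rV[K]_n))
    (pi_nice : nice_partition (gain_arrangement S) pi) (G_block : block G) :
  let Pi := induced_map pi_nice in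
  (forall r : 'I_s, Pi @^-1` [set r] !=set0 -> star (Pi @^-1` [set r])) /\
  (forall r t : 'I_s, r <> t ->
     Pi @^-1` [set r] !=set0 -> Pi @^-1` [set t] !=set0 ->
     ~ exists v : 'I_n, center v (Pi @^-1` [set r]) /\
                        center v (Pi @^-1` [set t])).
Proof.
move=> Pi; split=> [r|r t rt r0 t0 [v [cr ct]]].
  exact: coloured_preimage_star.
exact: coloured_centers_distinct G_block rt r0 t0 cr ct.
Qed.
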